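(* Let $\mathbf{p}=\mathbf{p}(n)=(p_{11},p_{10},p_{01},p_{00})$ be probability vectors depending on $n$ that satisfy $$p_{11}\le\frac{\log n-\omega(1)}{n},\qquad \frac{p_{01}p_{10}}{p_{11}p_{00}}<1 .$$ Let $(G_a,G_b)\sim ER(n,\mathbf{p})$, let $\Pi$ be a uniformly random permutation of $[n]$ independent of $(G_a,G_b)$, and let $G_c$ be the anonymization of $G_a$ by $\Pi$. Then any estimator for $\Pi$ given $(G_c,G_b)$ is correct (i.e. equals $\Pi$) with probability $o(1)$.
   Context: $[n]=\{0,1,\dots,n-1\}$, and $\binom{[n]}{2}$ is the set of two-element subsets of $[n]$. A graph on $[n]$ is identified with its edge indicator function $g:\binom{[n]}{2}\to\{0,1\}$. $ER(n,\mathbf{p})$ is the distribution of a pair of graphs $(G_a,G_b)$ on $[n]$ such that the pairs $(G_a(e),G_b(e))$, $e\in\binom{[n]}{2}$, are i.i.d. and $(G_a(e),G_b(e))=(i,j)$ with probability $p_{ij}$ for $i,j\in\{0,1\}$ (entries of $\mathbf{p}$ nonnegative, summing to 1). The anonymization $G_c$ of $G_a$ by $\Pi$ is given by $G_c(\{\Pi(i),\Pi(j)\})=G_a(\{i,j\})$ for all $i\neq j$. An estimator for $\Pi$ given $(G_c,G_b)$ is a (possibly randomized) function of $(G_c,G_b)$ with values in the permutations of $[n]$. $\log$ is the natural logarithm; asymptotic notation is as $n\to\infty$, and $\omega(1)$ denotes a quantity tending to $+\infty$. The condition $\frac{p_{01}p_{10}}{p_{11}p_{00}}<1$ presupposes $p_{11}p_{00}>0$.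 *)

(* Defs.v *)
From HB Require Import structures.
From mathcomp Require Import all_boot all_order all_algebra all_fingroup.
From mathcomp Require Import all_classical all_reals all_analysis.
Set Implicit Arguments.
Unset Strict Implicit.
Unset Printing Implicit Defensive.
Import Order.TTheory GRing.Theory Num.Theory.
Local Open Scope ring_scope.

Record fdist (R : realType) (A : finType) := FDist {
  pmf :> A -> R;
  pmf_ge0 : forall a, 0 <= pmf a;
  pmf_sum1 : \sum_a pmf a = 1 }.

Definition Pr (R : realType) (A : finType) (P : fdist R A) (E : pred A) : R :=
  \sum_(a | E a) P a.

Fact semidirect_ge0 (R : realType) (A B : finType) (P : fdist R A)
  (K : A -> fdist R B) (x : A * B) : 0 <= P x.1 * K x.1 x.2.
Proof. by apply: mulr_ge0; apply: pmf_ge0. Qed.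

Fact semidirect_sum1 (R : realType) (A B : finType) (P : fdist R A)
  (K : A -> fdist R B) : \sum_(x : A * B) P x.1 * K x.1 x.2 = 1.
Proof.
rewrite -(pair_bigA _ (fun a b => P a * K a b)) /= -[RHS](pmf_sum1 P).
by apply: eq_bigr => a _; rewrite -mulr_sumr pmf_sum1 mulr1.
Qed.

(* Law of (X, Y) where X has law P and, given X = a, Y has law K a. A constant
   kernel K makes Y independent of X. *)
Definition semidirect (R : realType) (A B : finType) (P : fdist R A)
    (K : A -> fdist R B) : fdist R (A * B)%type :=
  FDist (semidirect_ge0 P K) (semidirect_sum1 P K).

Fact uniform_perm_ge0 (R : realType) (n : nat) (s : {perm 'I_n}) :
  0 <= #|{perm 'I_n}|%:R^-1 :> R.
Proof. by rewrite invr_ge0 ler0n. Qed.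

Fact uniform_perm_sum1 (R : realType) (n : nat) :
  \sum_(s : {perm 'I_n}) #|{perm 'I_n}|%:R^-1 = 1 :> R.
Proof.
rewrite sumr_const -[LHS]mulr_natl divff // pnatr_eq0 -lt0n.
by apply/card_gt0P; exists 1%g.
Qed.

Definition uniform_perm (R : realType) (n : nat) : fdist R {perm 'I_n} :=
  FDist (@uniform_perm_ge0 R n) (uniform_perm_sum1 R n).

Definition edge (n : nat) := {e : {set 'I_n} | #|e| == 2%N}.

Definition graph (n : nat) := {ffun edge n -> bool}.

Fact imset_edge_subproof (n : nat) (s : {perm 'I_n}) (e : edge n) :
  #|s @: val e| == 2%N.
Proof. by rewrite card_imset ?(valP e) //; apply: perm_inj. Qed.

Definition imset_edge (n : nat) (s : {perm 'I_n}) (e : edge n) : edge n :=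
  exist _ (s @: val e) (imset_edge_subproof s e).

Definition anonymize (n : nat) (s : {perm 'I_n}) (g : graph n) : graph n :=
  [ffun e => g (imset_edge s^-1 e)].

Fact pair_edge_subproof (n : nat) (i j : 'I_n) (ij : i != j) :
  #|[set i; j]%SET| == 2%N.
Proof. by rewrite cards2 ij. Qed.

Definition pair_edge (n : nat) (i j : 'I_n) (ij : i != j) : edge n :=
  exist _ [set i; j]%SET (pair_edge_subproof ij).

(* The defining equation of the anonymization. *)
Lemma anonymizeE (n : nat) (s : {perm 'I_n}) (g : graph n) (i j : 'I_n)
    (ij : i != j) (sij : s i != s j) :
  anonymize s g (pair_edge sij) = g (pair_edge ij).
Proof.
rewrite ffunE; congr (g _); apply: val_inj => /=.
by rewrite imsetU !imset_set1 !permK.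
Qed.

Section ER.
Variables (R : realType) (n : nat) (p : fdist R (bool * bool)%type).

Definition ER_pmf (G : graph n * graph n) : R :=
  \prod_(e : edge n) p (G.1 e, G.2 e).

Fact ER_pmf_ge0 G : 0 <= ER_pmf G.
Proof. by apply: prodr_ge0 => e _; apply: pmf_ge0. Qed.

Fact ER_pmf_sum1 : \sum_G ER_pmf G = 1.
Proof.
pose h (G : graph n * graph n) : {ffun edge n -> bool * bool} :=
  [ffun e => (G.1 e, G.2 e)].
pose k (f : {ffun edge n -> bool * bool}) : graph n * graph n :=
  ([ffun e => (f e).1], [ffun e => (f e).2]).
have hK : cancel h k.
  by case=> a b; congr pair; apply/ffunP => e; rewrite !ffunE.
have kK : cancel k h.
  by move=> f; apply/ffunP => e; rewrite !ffunE; case: (f e).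
rewrite (reindex k); last by exists h => x _.
transitivity (\sum_(f : {ffun edge n -> bool * bool}) \prod_e p (f e)).
  apply: eq_bigr => f _; apply: eq_bigr => e _.
  by rewrite !ffunE; case: (f e).
rewrite -(bigA_distr_bigA (fun _ => p)) /=.
by apply: big1 => e _; apply: pmf_sum1.
Qed.

(* p (i, j) is the probability that an edge slot has value i in the first graph
   and j in the second. *)
Definition ER : fdist R (graph n * graph n)%type := FDist ER_pmf_ge0 ER_pmf_sum1.

End ER.

(* A randomized estimator is given by the conditional law of its output given
   the observed pair (G_c, G_b); deterministic estimators are the case of point
   masses. *)
Definition estimator (R : realType) (n : nat) :=
  graph n * graph n -> fdist R {perm 'I_n}.

(* Joint law of (((G_a, G_b), Pi), output of the estimator). *)
Definition joint_law (R : realType) (n : nat) (p : fdist R (bool * bool)%type)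
    (est : estimator R n) :
    fdist R (graph n * graph n * {perm 'I_n} * {perm 'I_n})%type :=
  semidirect (semidirect (ER n p) (fun=> uniform_perm R n))
    (fun x => let: ((Ga, Gb), s) := x in est (anonymize s Ga, Gb)).

Definition prob_correct (R : realType) (n : nat)
    (p : fdist R (bool * bool)%type) (est : estimator R n) : R :=
  Pr (joint_law p est) (fun x => x.2 == x.1.2).

(* Main.v *)
(* Since p01 p10 <= p11 p00, the likelihood of a relabeling of G_a does not
   decrease when it gains edges in common with G_b. Swapping two isolated
   vertices of the intersection graph keeps all common edges, so the true
   relabeling is at most as likely as I others, where I is the number of isolated
   vertices. Hence the estimator is correct with probability about E[1 / I].
   The intersection graph is an Erdos-Renyi graph of parameter p11, in which I
   has mean M = n (1 - p11)^(n - 1), which tends to infinity, and variance at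
   most M + M^2 p11 / (1 - p11). The pointwise inequality
   1 <= 2 I / M + (I / M - 1)^2 combines both facts into the bound
   3 / M + p11 / (1 - p11). *)
Require Import Defs.
From mathcomp Require Import all_boot all_order all_algebra all_fingroup.
From mathcomp Require Import all_classical all_reals all_analysis.
From mathcomp Require Import lra ring zify.
Set Implicit Arguments.
Unset Strict Implicit.
Unset Printing Implicit Defensive.
Import Order.TTheory GRing.Theory Num.Theory.
Import numFieldNormedType.Exports.
Local Open Scope classical_set_scope.
Local Open Scope ring_scope.

(** * Stars at a vertex and isolated vertices of the intersection graph *)

Definition incident (n : nat) (v : 'I_n) : {set edge n} :=
  [set e : edge n | v \in val e]%SET.

(** An arbitrary edge set is allowed because the second moment needs unions of two stars. *)
Definition no_common_edge (n : nat) (F : {set edge n})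
    (G : graph n * graph n) : bool :=
  [forall e in F, ~~ (G.1 e && G.2 e)].

Definition isolated (n : nat) (G : graph n * graph n) : {set 'I_n} :=
  [set v | no_common_edge (incident v) G]%SET.

Section Incidence.
Variable n : nat.
Implicit Types u v : 'I_n.

Lemma card_incident v : #|incident v| = n.-1.
Proof.
have -> : n.-1 = #|[set~ v]%SET| by rewrite cardsC1 card_ord.
pose h (j : 'I_n) : {set 'I_n} := [set v; j]%SET.
have hinj : {in [set~ v]%SET &, injective h}.
  move=> j k; rewrite !inE => jv kv /setP /(_ j).
  by rewrite !inE eqxx orbT (negPf jv) /= => /esym /eqP.
rewrite -(card_in_imset hinj) -(card_imset _ val_inj).
apply: eq_card => /= A; apply/imsetP/imsetP => [[e]|[j]].
  rewrite inE => ve ->; have /cards2P [x [y [xy exy]]] := valP e.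
  move: ve; rewrite exy !inE => /orP[] /eqP vE.
    by exists y; rewrite ?inE /h vE // eq_sym.
  by exists x; rewrite ?inE /h vE // finset.setUC.
rewrite !inE => jv ->.
have vj : v != j by rewrite eq_sym.
by exists (pair_edge vj) => //; rewrite !inE eqxx.
Qed.

Lemma card_incidentI u v : u != v -> #|incident u :&: incident v| = 1%N.
Proof.
move=> uv; apply/eqP/cards1P; exists (pair_edge uv).
apply/setP => e; rewrite !inE; apply/andP/eqP => [[ue ve]|->]; last first.
  by rewrite !inE !eqxx orbT.
apply/val_inj/esym/eqP; rewrite /= eqEcard (eqP (valP e)) cards2 uv leqnn andbT.
by apply/fintype.subsetP => x; rewrite !inE => /orP[] /eqP ->.
Qed.

(** The edge joining [u] and [v] lies in both stars. The successor will absorb the extra factor [q]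
    in the second moment. *)
Lemma card_incidentU u v : u != v ->
  #|incident u :|: incident v|.+1 = (n.-1 + n.-1)%N.
Proof.
move=> uv; have := cardsUI (incident u) (incident v).
by rewrite !card_incident card_incidentI// addn1.
Qed.

Lemma no_common_edgeU (F F' : {set edge n}) G :
  no_common_edge (F :|: F') G = no_common_edge F G && no_common_edge F' G.
Proof.
apply/forall_inP/andP => [H|[/forall_inP H /forall_inP H'] e].
  by split; apply/forall_inP => e eF; apply: H; rewrite inE eF ?orbT.
by rewrite inE => /orP[]; [apply: H|apply: H'].
Qed.

End Incidence.

(** * Likelihood as a function of the number of common edges *)

Section Likelihood.
Variables (R : realType) (n : nat) (p : fdist R (bool * bool)%type).
Implicit Types g h : graph n.

Definition edges g : nat := \sum_e g e.
Definition common g h : nat := \sum_e (g e && h e).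

Lemma common_le_edges g h : (common g h <= edges g)%N.
Proof. by apply: leq_sum => e _; case: (g e) (h e) => -[]. Qed.

Lemma commonC g h : common g h = common h g.
Proof. by apply: eq_bigr => e _; rewrite andbC. Qed.

(** Each exponent counts the edge slots of one type, so no subtraction truncates. Once both edge
    counts are fixed, only the number of common edges matters. *)
Lemma ER_pmfE g h :
  ER n p (g, h) = p (true, true) ^+ common g h
    * p (true, false) ^+ (edges g - common g h)
    * p (false, true) ^+ (edges h - common g h)
    * p (false, false) ^+ (#|{: edge n}| + common g h - edges g - edges h).
Proof.
have E1 : (edges g - common g h = \sum_e (g e && ~~ h e))%N.
  apply/eqP; rewrite -(eqn_add2r (common g h)) subnK ?common_le_edges//.
  rewrite -big_split; apply/eqP; apply: eq_bigr => e _.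
  by case: (g e) (h e) => -[].
have E2 : (edges h - common g h = \sum_e (~~ g e && h e))%N.
  rewrite commonC; apply/eqP.
  rewrite -(eqn_add2r (common h g)) subnK ?common_le_edges//.
  rewrite -big_split; apply/eqP; apply: eq_bigr => e _.
  by case: (g e) (h e) => -[].
have E3 : (#|{: edge n}| + common g h - edges g - edges h
           = \sum_e (~~ g e && ~~ h e))%N.
  have -> : (#|{: edge n}| + common g h
    = edges g + (edges h + \sum_e (~~ g e && ~~ h e)))%N.
    rewrite -sum1_card -!big_split; apply: eq_bigr => e _.
    by case: (g e) (h e) => -[].
  by rewrite !addKn.
rewrite E1 E2 E3 /= /ER_pmf -!prodrXr -!big_split; apply: eq_bigr => e _ /=.
by case: (g e) (h e) => -[]; rewrite /= !expr0 expr1 ?mulr1 ?mul1r.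
Qed.

Lemma common_edges_le g h : (edges g + edges h <= #|{: edge n}| + common g h)%N.
Proof.
rewrite -sum1_card -!big_split; apply: leq_sum => e _ /=.
by case: (g e) (h e) => -[].
Qed.

Hypothesis corr :
  p (false, true) * p (true, false) <= p (true, true) * p (false, false).

(** At fixed edge counts, [k] more common edges turn [k] slots (1,0) and [k] slots (0,1) into [k]
    slots (1,1) and [k] slots (0,0). A factor [(p01 p10)^k] thus becomes [(p11 p00)^k]. *)
Lemma ER_pmf_mono g g' h : edges g = edges g' ->
  (common g h <= common g' h)%N -> ER n p (g, h) <= ER n p (g', h).
Proof.
move=> gg' le_c; rewrite !ER_pmfE gg'.
have := common_le_edges g' h; have := common_le_edges h g'.
have := common_edges_le g h; rewrite commonC gg'.
have -> : common h g' = (common g h + (common g' h - common g h))%N.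
  by rewrite subnKC// commonC.
have -> : common g' h = (common g h + (common g' h - common g h))%N.
  by rewrite subnKC.
rewrite addKn [common h g]commonC; move: (common g h) (common g' h - common g h)%N.
move: (edges g') (edges h) #|{: edge n}| => a b N c k H1 H2 H3.
have -> : (a - c = (a - (c + k)) + k)%N by lia.
have -> : (b - c = (b - (c + k)) + k)%N by lia.
have -> : (N + (c + k) - a - b = (N + c - a - b) + k)%N by lia.
rewrite !exprD.
set x := p (true, true); set y := p (true, false); set z := p (false, true).
set t := p (false, false).
have -> : forall A B C D, A * (B * y ^+ k) * (C * z ^+ k) * D
  = (A * B * C * D) * (z * y) ^+ k by move=> *; rewrite exprMn; ring.
have -> : forall A B C D, A * x ^+ k * B * C * (D * t ^+ k)
  = (A * B * C * D) * (x * t) ^+ k by move=> *; rewrite exprMn; ring.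
have [x0 y0 z0 t0] : [/\ 0 <= x, 0 <= y, 0 <= z & 0 <= t].
  by split; apply: Defs.pmf_ge0.
apply: ler_wpM2l; first by rewrite !mulr_ge0 ?exprn_ge0.
by apply: lerXn2r; rewrite // nnegrE mulr_ge0.
Qed.

End Likelihood.

(** * Action of permutations on graphs *)

Section Anonymize.
Variable n : nat.
Implicit Types (s t : {perm 'I_n}) (g h : graph n) (e : edge n).

Lemma imset_edgeK s : cancel (imset_edge s) (imset_edge s^-1).
Proof.
move=> e; apply: val_inj; rewrite /= -imset_comp -[RHS]imset_id.
by apply: eq_imset => x /=; rewrite permK.
Qed.

Lemma imset_edgeKV s : cancel (imset_edge s^-1) (imset_edge s).
Proof. by have := imset_edgeK s^-1; rewrite invgK. Qed.

Lemma anonymizeM s t g : anonymize (s * t) g = anonymize t (anonymize s g).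
Proof.
apply/ffunP => e; rewrite !ffunE; congr (g _); apply: val_inj => /=.
by rewrite -imset_comp; apply: eq_imset => x /=; rewrite invMg permM.
Qed.

Lemma anonymizeK s : cancel (anonymize s) (anonymize s^-1).
Proof. by move=> g; apply/ffunP => e; rewrite !ffunE invgK imset_edgeK. Qed.

Lemma anonymizeKV s : cancel (anonymize s^-1) (anonymize s).
Proof. by have := anonymizeK s^-1; rewrite invgK. Qed.

Lemma edges_anonymize s g : edges (anonymize s g) = edges g.
Proof.
rewrite /edges (reindex (imset_edge s)) /=; last first.
  by exists (imset_edge s^-1) => e _; rewrite (imset_edgeK, imset_edgeKV).
by apply: eq_bigr => e _; rewrite ffunE imset_edgeK.
Qed.

(* An edge common to [g] and [h] avoids [u] and [v], so it is fixed. *)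
Lemma common_tperm g h u v :
  u \in isolated (g, h) -> v \in isolated (g, h) ->
  (common g h <= common (anonymize (tperm u v) g) h)%N.
Proof.
rewrite !inE => /forall_inP Iu /forall_inP Iv; apply: leq_sum => e _.
case: (boolP (g e && h e)) => // ghe; rewrite ffunE.
have ue : u \notin val e.
  by apply/negP => ue; have := Iu e; rewrite inE ue ghe => /(_ isT).
have ve : v \notin val e.
  by apply/negP => ve; have := Iv e; rewrite inE ve ghe => /(_ isT).
suff -> : imset_edge (tperm u v)^-1 e = e by rewrite ghe.
apply: val_inj; rewrite /= tpermV -[RHS]imset_id; apply: eq_in_imset => x xe.
by rewrite tpermD//; apply/eqP => xE; move: ue ve; rewrite xE xe.
Qed.

End Anonymize.

(** * First two moments of the number of isolated vertices *)

Section Moments.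
Variables (R : realType) (n : nat) (p : fdist R (bool * bool)%type).

Let q : R := 1 - p (true, true).

(** Independence of the edge slots, obtained by distributing the product over the sums. *)
Lemma ER_sum_prod (f : edge n -> bool * bool -> R) :
  \sum_G ER n p G * \prod_e f e (G.1 e, G.2 e) = \prod_e \sum_x p x * f e x.
Proof.
rewrite (bigA_distr_bigA (fun e x => p x * f e x)) /=.
pose k (c : {ffun edge n -> bool * bool}) : graph n * graph n :=
  ([ffun e => (c e).1], [ffun e => (c e).2]).
rewrite (reindex k); last first.
  exists (fun G : graph n * graph n => [ffun e => (G.1 e, G.2 e)]).
    by move=> c _; apply/ffunP => e; rewrite !ffunE; case: (c e).
  by case=> g h _; congr pair; apply/ffunP => e; rewrite !ffunE.
apply: eq_bigr => c _; rewrite -big_split; apply: eq_bigr => e _.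
by rewrite !ffunE; case: (c e).
Qed.

Lemma ER_no_common_edge (F : {set edge n}) :
  \sum_G ER n p G * (no_common_edge F G)%:R = q ^+ #|F|.
Proof.
(* The indicator of the event is the product of these factors, which are 1 off [F]. *)
pose f (e : edge n) (x : bool * bool) : R :=
  if e \in F then (~~ (x.1 && x.2))%:R else 1.
transitivity (\sum_G ER n p G * \prod_e f e (G.1 e, G.2 e)).
  apply: eq_bigr => G _; congr (_ * _).
  rewrite -big_mkcond /= /no_common_edge; case: forall_inP => [H|H].
    by rewrite big1// => e /H ->.
  have [e /andP[eF Ge]] : exists e, (e \in F) && (G.1 e && G.2 e).
    apply/existsP; rewrite -[X in is_true X]negbK negb_exists.
    apply/negP => /forallP H'; apply: H => e eF.
    by have := H' e; rewrite eF.
  by rewrite (bigD1 e)//= Ge mul0r.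
rewrite ER_sum_prod -prodr_const [RHS]big_mkcond; apply: eq_bigr => e _.
have sumE (g : bool * bool -> R) : \sum_x g x = g (true, true)
    + g (true, false) + (g (false, true) + g (false, false)).
  rewrite (eq_bigr (fun x => g (x.1, x.2))); last by case.
  by rewrite -(pair_bigA _ (fun a b => g (a, b))) !big_bool.
have := pmf_sum1 p; rewrite !sumE.
rewrite /f /q; case: (e \in F) => /=; lra.
Qed.

Definition mean_isolated : R := n%:R * q ^+ n.-1.

Let I (G : graph n * graph n) : R := #|isolated G|%:R.

Lemma card_isolatedE (G : graph n * graph n) :
  I G = \sum_v (no_common_edge (incident v) G)%:R.
Proof.
rewrite /I -sum1_card big_mkcond natr_sum; apply: eq_bigr => v _.
by rewrite inE; case: ifP.
Qed.

Lemma ER_mean_isolated : \sum_G ER n p G * I G = mean_isolated.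
Proof.
under eq_bigr do rewrite card_isolatedE mulr_sumr.
rewrite exchange_big /=.
under eq_bigr do rewrite ER_no_common_edge card_incident.
by rewrite sumr_const card_ord /mean_isolated mulr_natl.
Qed.

(** Two distinct stars cover [2(n-1) - 1] edges; multiplying by [q] completes the exponent to
    [2(n-1)] without a division. The diagonal gives the mean. *)
Lemma ER_second_moment_isolated : 0 <= q ->
  q * (\sum_G ER n p G * I G ^+ 2) <= q * mean_isolated + mean_isolated ^+ 2.
Proof.
move=> q0.
have -> : \sum_G ER n p G * I G ^+ 2
    = \sum_(u < n) \sum_(v < n) q ^+ #|incident u :|: incident v|.
  under [RHS]eq_bigr do under eq_bigr do rewrite -ER_no_common_edge.
  under [RHS]eq_bigr do rewrite exchange_big.
  rewrite [RHS]exchange_big; apply: eq_bigr => G _ /=.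
  rewrite expr2 {1}card_isolatedE mulr_suml mulr_sumr; apply: eq_bigr => u _.
  rewrite -[RHS]mulr_sumr; congr (_ * _).
  rewrite card_isolatedE mulr_sumr; apply: eq_bigr => v _.
  by rewrite no_common_edgeU -natrM mulnb.
have row (u : 'I_n) : q * \sum_v q ^+ #|incident u :|: incident v|
    <= q * q ^+ n.-1 + n%:R * (q ^+ n.-1 * q ^+ n.-1).
  rewrite (bigD1 u) //= finset.setUid card_incident mulrDr lerD2l mulr_sumr.
  (* The missing term at [v = u] is replaced by a nonnegative one, so that [n - 1] terms become
     [n]. *)
  rewrite -[n in n%:R]card_ord -sum1_card natr_sum mulr_suml.
  rewrite big_mkcond; apply: ler_sum => v _; case: ifPn => [vu|_].
    by rewrite mul1r -exprS -exprD card_incidentU// eq_sym.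
  by rewrite mul1r mulr_ge0// exprn_ge0.
rewrite mulr_sumr; apply: le_trans (ler_sum _ (fun u _ => row u)) _.
rewrite sumr_const card_ord /mean_isolated -[leLHS]mulr_natl; set a := q ^+ n.-1.
by rewrite [leLHS](_ : _ = q * (n%:R * a) + (n%:R * a) ^+ 2) ?lexx//; ring.
Qed.

Lemma ER_variance_isolated : 0 <= q ->
  q * (\sum_G ER n p G * (I G - mean_isolated) ^+ 2)
    <= q * mean_isolated + (1 - q) * mean_isolated ^+ 2.
Proof.
move=> q0; have := ER_second_moment_isolated q0.
have -> : \sum_G ER n p G * (I G - mean_isolated) ^+ 2
    = \sum_G ER n p G * I G ^+ 2 - mean_isolated ^+ 2.
  transitivity (\sum_G (ER n p G * I G ^+ 2
     - (mean_isolated *+ 2) * (ER n p G * I G) + mean_isolated ^+ 2 * ER n p G)).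
    by apply: eq_bigr => G _; ring.
  rewrite !big_split /= sumrN -!mulr_sumr ER_mean_isolated (pmf_sum1 (ER n p)); ring.
set S := \sum_G _; move: S mean_isolated => S M; lra.
Qed.

End Moments.

(** * Bayesian comparison of the candidate permutations *)

Section Alignment.
Variables (R : realType) (n : nat) (p : fdist R (bool * bool)%type).

Let c : R := #|{perm 'I_n}|%:R^-1.

(** For each fixed [s], relabeling the first graph is a bijection on pairs, and the weights [c] sum
    to 1. *)
Lemma sum_anonymize_inv (F : graph n * graph n -> R) :
  \sum_G \sum_(s : {perm 'I_n}) c * F (anonymize s^-1 G.1, G.2) = \sum_G F G.
Proof.
rewrite exchange_big /=.
have inner (s : {perm 'I_n}) :
    \sum_G c * F (anonymize s^-1 G.1, G.2) = c * \sum_G F G.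
  rewrite -mulr_sumr; congr (_ * _).
  pose a (t : {perm 'I_n}) (G : graph n * graph n) := (anonymize t G.1, G.2).
  rewrite (reindex (a s)) /=; last first.
    exists (a s^-1%g) => -[g h] _; rewrite /a /=.
      by rewrite anonymizeK.
    by rewrite anonymizeKV.
  by apply: eq_bigr => -[g h] _; rewrite /= anonymizeK.
under eq_bigr do rewrite inner.
by rewrite -mulr_suml (uniform_perm_sum1 R n) mul1r.
Qed.

(** Change of variables to the observed pair [G]: the hidden graph is [anonymize s^-1 G.1], and the
    first two factors form the joint mass of [G] and [s]. *)
Lemma prob_correctE (est : estimator R n) :
  prob_correct p est = \sum_G \sum_(s : {perm 'I_n})
    c * ER n p (anonymize s^-1 G.1, G.2) * est G s.
Proof.
transitivity (\sum_(s : {perm 'I_n}) \sum_G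
    c * ER n p G * est (anonymize s G.1, G.2) s).
  rewrite exchange_big /prob_correct /Pr big_mkcond /=.
  pose f (x : graph n * graph n * {perm 'I_n}) (o : {perm 'I_n}) : R :=
    if o == x.2 then joint_law p est (x, o) else 0.
  rewrite (eq_bigr (fun x => f x.1 x.2)); last by case=> -[].
  rewrite -(pair_bigA _ f).
  pose k (G : graph n * graph n) (s : {perm 'I_n}) : R := \sum_o f (G, s) o.
  rewrite (eq_bigr (fun x => k x.1 x.2)); last by case.
  rewrite -(pair_bigA _ k); apply: eq_bigr => -[g h] _; apply: eq_bigr => s _.
  rewrite /k /f -big_mkcond big_pred1_eq /=.
  by rewrite -[ER_pmf _ _ * _]mulrC.
rewrite [RHS]exchange_big; apply: eq_bigr => s _ /=.
pose a (t : {perm 'I_n}) (G : graph n * graph n) := (anonymize t G.1, G.2).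
rewrite (reindex (a s^-1%g)) /=; last first.
  exists (a s) => -[g h] _; rewrite /a /=.
    by rewrite anonymizeKV.
  by rewrite anonymizeK.
by apply: eq_bigr => -[g h] _; rewrite /a /= anonymizeKV.
Qed.

Lemma fdist_le1 (A : finType) (P : fdist R A) (a : A) : P a <= 1.
Proof.
rewrite -(pmf_sum1 P) (bigD1 a) //= lerDl sumr_ge0// => b _.
exact: Defs.pmf_ge0.
Qed.

Hypothesis corr :
  p (false, true) * p (true, false) <= p (true, true) * p (false, false).

(* Swapping one isolated vertex of the intersection graph with each of them
   gives as many distinct relabelings that are at least as likely. *)
Lemma isolated_likelihood (g h : graph n) :
  ER n p (g, h) * #|isolated (g, h)|%:R
    <= \sum_(t : {perm 'I_n}) ER n p (anonymize t g, h).
Proof.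
have P0 G : 0 <= ER n p G by exact: Defs.pmf_ge0.
have [->|[u uI]] := set_0Vmem (isolated (g, h)).
  by rewrite cards0 mulr0 sumr_ge0.
have inj_u : {in isolated (g, h) &, injective (tperm u)}.
  by move=> v w _ _ /(congr1 (fun t : {perm 'I_n} => t u)); rewrite !tpermL.
apply: (@le_trans _ _
  (\sum_(t in tperm u @: isolated (g, h)) ER n p (anonymize t g, h))).
  rewrite big_imset //= mulr_natr -sumr_const; apply: ler_sum => v vI.
  apply: ER_pmf_mono => //; first by rewrite edges_anonymize.
  exact: common_tperm.
rewrite [leRHS](bigID (mem (tperm u @: isolated (g, h)))) /= lerDl.
by apply: sumr_ge0 => t _; apply: P0.
Qed.

Lemma prob_correct_le (est : estimator R n) :
  0 < mean_isolated n p -> 0 < 1 - p (true, true) ->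
  prob_correct p est
    <= 3 / mean_isolated n p + p (true, true) / (1 - p (true, true)).
Proof.
move=> M0 q0; set M := mean_isolated n p in M0 *.
pose L (G : graph n * graph n) (s : {perm 'I_n}) : R :=
  ER n p (anonymize s^-1 G.1, G.2).
pose V (G : graph n * graph n) : R := ER n p G * (#|isolated G|%:R - M) ^+ 2.
have L0 G s : 0 <= L G s by exact: Defs.pmf_ge0.
have c0 : 0 <= c by rewrite invr_ge0.
(* The sum over [t] does not depend on [s], so [est G] sums out to 1 and the first term totals
   [2 / M]. The second term averages to the variance over [M ^+ 2]. *)
have L_le G s : L G s * est G s <= 2 / M * (\sum_t L G t) * est G s
    + V (anonymize s^-1 G.1, G.2) / M ^+ 2.
  have LI := isolated_likelihood (anonymize s^-1 G.1) G.2.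
  have {}LI : L G s * #|isolated (anonymize s^-1 G.1, G.2)|%:R
      <= \sum_t L G t.
    apply: le_trans LI _.
    (* Relabeling the hidden graph by [t] amounts to the candidate [(s^-1 * t)^-1]. *)
    rewrite [leRHS](reindex_inj (inj_comp invg_inj (mulgI s^-1%g))) /=.
    by apply: ler_sum => t _; rewrite /L invgK anonymizeM.
  rewrite /V -/(L G s).
  move: (#|_|%:R) LI => I LI.
  have e1 := fdist_le1 (est G) s; have e0 := Defs.pmf_ge0 (est G) s.
  move: (L G s) (\sum_t _) (est G s) (L0 G s) LI e0 e1 => l S e l0 lI e0 e1.
  (* 1 <= 2 x + (x - 1) ^ 2 for x = I / M *)
  have -> : 2 / M * S * e + l * (I - M) ^+ 2 / M ^+ 2
     = l * e + (2 / M * e * (S - l * I)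
       + l * e * (I / M) ^+ 2 + (1 - e) * l * (I / M - 1) ^+ 2).
    by field; rewrite gt_eqF.
  have := sqr_ge0 (I / M); have := sqr_ge0 (I / M - 1).
  move: ((I / M - 1) ^+ 2) ((I / M) ^+ 2) => y x y0 x0.
  by rewrite lerDl !addr_ge0 // !mulr_ge0 ?subr_ge0 ?invr_ge0 ?(ltW M0).
rewrite prob_correctE.
(* The third [1 / M] comes from the variance, as [M / M ^+ 2]. *)
have -> : 3 / M + p (true, true) / (1 - p (true, true))
   = 2 / M + (M + p (true, true) / (1 - p (true, true)) * M ^+ 2) / M ^+ 2.
  by field; rewrite !gt_eqF.
apply: (@le_trans _ _ (2 / M * (\sum_G \sum_s c * L G s)
    + (\sum_G \sum_s c * V (anonymize s^-1 G.1, G.2)) / M ^+ 2)).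
  rewrite mulr_sumr mulr_suml -big_split; apply: ler_sum => G _ /=.
  apply: (@le_trans _ _ (\sum_s c * (2 / M * (\sum_t L G t) * est G s
    + V (anonymize s^-1 G.1, G.2) / M ^+ 2))).
    by apply: ler_sum => s _; rewrite -mulrA ler_wpM2l //; apply: L_le.
  rewrite -mulr_sumr big_split /= -mulr_sumr pmf_sum1 mulr1 -mulr_suml.
  rewrite mulrDr lerD//.
    by rewrite -mulr_sumr mulrCA.
  by rewrite -mulr_sumr mulrA.
rewrite (sum_anonymize_inv (ER n p)) sum_anonymize_inv (pmf_sum1 (ER n p)) mulr1 lerD2l.
rewrite ler_wpM2r ?invr_ge0 ?sqr_ge0//.
have := ER_variance_isolated n (ltW q0); rewrite -/M.
rewrite -ler_pdivlMl// => /le_trans; apply.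
rewrite le_eqVlt; apply/orP; left; apply/eqP; field.
by rewrite gt_eqF.
Qed.

End Alignment.

(** * Lower bound on the mean number of isolated vertices *)

Section Asymptotics.
Variable R : realType.

(** Twice the inequality [ln y < y] at the square root of [x]. *)
Lemma ln_le_sqrt (x : R) : 0 < x -> ln x <= 2 * Num.sqrt x.
Proof.
move=> x0; have s0 : 0 < Num.sqrt x by rewrite sqrtr_gt0.
rewrite -{1}(sqr_sqrtr (ltW x0)) lnXn// -[leLHS]mulr_natl ler_pM2l//.
exact/ltW/ln_sublinear.
Qed.

(** Uses [1 + x <= expR x] at [x = a / (1 - a)], where [1 + x] is the inverse of [1 - a]. *)
Lemma one_sub_expn_ge (a : R) (n : nat) : 0 <= a -> a < 1 ->
  expR (- (n%:R * (a / (1 - a)))) <= (1 - a) ^+ n.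
Proof.
move=> a0 a1; have q0 : 0 < 1 - a by lra.
rewrite -mulrN expRM_natl lerXn2r ?nnegrE ?expR_ge0 ?(ltW q0)//.
rewrite expRN invf_ple ?posrE ?expR_gt0//.
rewrite [leLHS](_ : _ = 1 + a / (1 - a)); first exact: expR_ge1Dx.
by field; rewrite gt_eqF.
Qed.

(** With [a] for [p11], the 8 bounds [n a^2 / (1 - a)], the excess of [n a / (1 - a)] over [n a]:
    here [n a^2 <= 4] and [1 / (1 - a) <= 2]. The threshold 16 makes the square root at least 4,
    whence [a <= 1 / 2]. *)
Lemma mean_isolated_ge (p : fdist R (bool * bool)%type) (n : nat) (w : R) :
  (16 <= n)%N -> 0 <= w -> p (true, true) <= (ln n%:R - w) / n%:R ->
  [/\ p (true, true) * Num.sqrt n%:R <= 2, p (true, true) <= 1 / 2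
    & expR (w - 8) <= mean_isolated n p].
Proof.
set a := p (true, true) => n16 w0 a_le.
have n0 : 0 < n%:R :> R by rewrite ltr0n; lia.
have a0 : 0 <= a by exact: Defs.pmf_ge0.
have s0 : 0 < Num.sqrt n%:R :> R by rewrite sqrtr_gt0.
have sE : Num.sqrt n%:R ^+ 2 = n%:R :> R by rewrite sqr_sqrtr// ltW.
have s4 : 4 <= Num.sqrt n%:R :> R.
  rewrite -(@ler_pXn2r _ 2) ?nnegrE ?(ltW s0)// sE.
  have : 16 <= n%:R :> R by rewrite ler_nat.
  lra.
have an : n%:R * a <= ln n%:R - w by rewrite mulrC -ler_pdivlMr.
have lns := ln_le_sqrt n0.
have as2 : a * Num.sqrt n%:R <= 2.
  rewrite -(ler_pM2r s0) -mulrA -expr2 sE mulrC; lra.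
have a12 : a <= 1 / 2 by nra.
split=> //.
have a1 : a < 1 by lra.
(* Raising the exponent from [n - 1] to [n] only lowers the power. *)
apply: (@le_trans _ _ (n%:R * (1 - a) ^+ n)); last first.
  rewrite /mean_isolated -/a ler_pM2l// -{1}[n]prednK ?(leq_trans _ n16)//.
  by rewrite exprS ler_piMl ?exprn_ge0//; lra.
apply: le_trans (ler_wpM2l (ltW n0) (one_sub_expn_ge n a0 a1)).
have {1}-> : n%:R = expR (ln n%:R) :> R by rewrite lnK.
rewrite -expRD ler_expR.
have -> : a / (1 - a) = a + a ^+ 2 / (1 - a) by field; rewrite gt_eqF//; lra.
have : n%:R * a ^+ 2 <= 4.
  rewrite -sE -exprMn mulrC; nra.
have : (1 - a)^-1 <= 2 by rewrite invf_ple ?posrE; lra.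
have : 0 <= (1 - a)^-1 by rewrite invr_ge0; lra.
move: (1 - a)^-1 => v v0 v2 na4; nra.
Qed.

End Asymptotics.

(** * Conclusion by choice of thresholds *)

Theorem theorem2 (R : realType) (p : nat -> fdist R (bool * bool)%type)
  (w : nat -> R)
  (w_infty : w n @[n --> \oo] --> +oo)
  (p11_le : \forall n \near \oo,
     p n (true, true) <= (ln n%:R - w n) / n%:R)
  (p11p00_gt0 : forall n, 0 < p n (true, true) * p n (false, false))
  (ratio_lt1 : forall n,
     p n (false, true) * p n (true, false)
       / (p n (true, true) * p n (false, false)) < 1)
  (est : forall n, estimator R n) :
  prob_correct (p n) (est n) @[n --> \oo] --> (0 : R).
Proof.
have corr n : p n (false, true) * p n (true, false)
    <= p n (true, true) * p n (false, false).
  by rewrite -[leRHS]mul1r -ler_pdivrMr// ltW.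
apply/cvgr0Pnorm_le => e e0.
(* Then the mean is at least [expR (w n - 8) >= w n - 7 >= 6 / e], so [3 / M <= e / 2]. *)
have w_ge : \forall n \near \oo, 7 + 6 / e <= w n.
  by move/cvgryPge : w_infty; apply.
(* Then [p11 <= 2 / sqrt n <= e / 4], and [p11 <= 1 / 2] gives [p11 / (1 - p11) <= e / 2]. *)
have n_ge : \forall n \near \oo, (8 / e) ^+ 2 <= n%:R by exact: nbhs_infty_ger.
near=> n.
have n16 : (16 <= n)%N by near: n; exists 16%N.
have wn_ge : 7 + 6 / e <= w n by near: n.
have nn_ge : (8 / e) ^+ 2 <= n%:R by near: n.
have pn_le : p n (true, true) <= (ln n%:R - w n) / n%:R by near: n.
have e60 : 0 < 6 / e by rewrite divr_gt0.
have e80 : 0 < 8 / e by rewrite divr_gt0.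
have wn0 : 0 <= w n by lra.
have [ps2 p12 M_exp] := mean_isolated_ge n16 wn0 pn_le.
have M_ge : 6 / e <= mean_isolated n (p n).
  by apply: le_trans M_exp; have := expR_ge1Dx (w n - 8); lra.
have s_ge : 8 / e <= Num.sqrt n%:R.
  by rewrite -[leLHS]ger0_norm ?(ltW e80)// -sqrtr_sqr ler_wsqrtr.
have M0 := lt_le_trans e60 M_ge.
have q0 : 0 < 1 - p n (true, true) by lra.
rewrite ger0_norm; last by apply: sumr_ge0 => x _; apply: Defs.pmf_ge0.
apply: le_trans (prob_correct_le (corr n) (est n) M0 q0) _.
have p0 : 0 <= p n (true, true) by exact: Defs.pmf_ge0.
have -> : e = e / 2 + e / 2 by lra.
apply: lerD.
  by move: M_ge; rewrite !ler_pdivrMr//; lra.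
rewrite ler_pdivrMr//.
have : p n (true, true) * (8 / e) <= 2 by apply: le_trans ps2; rewrite ler_wpM2l.
rewrite mulrA ler_pdivrMr// => pe; nra.
Unshelve. all: by end_near.
Qed.
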